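(* There is no finite group $K$ with a Kantor family $(\mathcal{F},\mathcal{F}^* )$ satisfying all of the following conditions: (i) there are distinct members $A, B \in \mathcal{F}$ such that $A^* \cap B^* \leq Z(K)$ and $K/(A^*\cap B^* )$ is abelian; (ii) the center $Z(K)$ has exponent $4$; (iii) every element of $\mathcal{F}$ is an elementary abelian $2$-group.
   Context: Let $K$ be a finite group of order $u^2v$, where $u$ and $v$ are integers, both at least $2$. A Kantor family (of type $(u,v)$) in $K$ is a pair $(\mathcal{F},\mathcal{F}^* )$ of sets of subgroups of $K$ such that: (a) $|\mathcal{F}| = |\mathcal{F}^*| = v+1$, and there is a bijection $*:\mathcal{F}\to\mathcal{F}^*$ mapping each $A\in\mathcal{F}$ to $A^*\in\mathcal{F}^*$ with $A \leq A^*$; (b) for each $A \in \mathcal{F}$, $|A| = u$ and $|A^*| = uv$; (c) if $A,B,C$ are pairwise different elements of $\mathcal{F}$, then $AB\cap C = \{\mathrm{id}\}$; (d) if $A$ and $B$ are different elements of $\mathcal{F}$, then $A\cap B^* = \{\mathrm{id}\}$. $Z(K)$ denotes the center of $K$. *)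

(* Defs.v *)
From mathcomp Require Import all_boot all_fingroup all_solvable.

Set Implicit Arguments.
Unset Strict Implicit.
Unset Printing Implicit Defensive.

Local Open Scope group_scope.

(* Kantor family (F, Fs) of type (u, v) in K. The function [star] is the
   bijection F -> Fs; its values outside F are irrelevant. In [kf_cap3],
   A * B is the setwise product, which need not be a subgroup. *)
Record kantor_family (gT : finGroupType) (K : {group gT}) (u v : nat)
    (F Fs : {set {group gT}}) (star : {group gT} -> {group gT}) : Prop :=
  KantorFamily {
    kf_u_ge2 : 2 <= u;
    kf_v_ge2 : 2 <= v;
    kf_order : #|K| = (u ^ 2 * v)%N;
    kf_sub : F \subset subgroups K;
    kf_star_sub : Fs \subset subgroups K;
    kf_card : #|F| = v.+1;
    kf_star_card : #|Fs| = v.+1;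
    kf_star_inj : {in F &, injective star};
    kf_star_im : star @: F = Fs;
    kf_le_star : forall A : {group gT}, A \in F -> A \subset star A;
    kf_card_mem : forall A : {group gT}, A \in F -> #|A| = u;
    kf_card_star : forall A : {group gT}, A \in F -> #|star A| = (u * v)%N;
    kf_cap3 : forall A B C : {group gT}, A \in F -> B \in F -> C \in F ->
      A != B -> B != C -> A != C -> (A * B) :&: C = 1;
    kf_cap_star : forall A B : {group gT}, A \in F -> B \in F ->
      A != B -> A :&: star B = 1
  }.

(* Main.v *)
Require Import Defs.
From mathcomp Require Import all_boot all_order all_algebra.
From mathcomp Require Import all_fingroup all_solvable all_field all_character.
From mathcomp Require Import zify ring.

Set Implicit Arguments.
Unset Strict Implicit.
Unset Printing Implicit Defensive.

Import GRing.Theory Num.Theory.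

(** With [S = A* :&: B*], every [g] in [K] is uniquely [b a s] with [a] in [A],
    [b] in [B] and [s] in the central subgroup [S], of order [v]; write
    [alpha g = a], [beta g = b] and [sigma g = s]. Conditions (c) and (d) and a
    count show that [(alpha, sigma)] maps the disjoint union of the [C^#], for
    [C] in [F] other than [A] and [B], bijectively onto [A^# x S^#].
    Since [Z(K)] has exponent 4, some [s] in [S] has [s^2 <> 1], hence some
    linear character [chi] of [S] has [chi (s^2) <> 1]. By the bijection, the
    sums [G_C = \sum_(x in C) chi (sigma x)] add up to [v - u]; so do the sums
    of [chi^2], and each of those is [0] or [u], so [u] divides [v - u].
    On [C], [chi \o sigma] is a quadratic function whose polarization
    [chi [~ alpha x, beta y]] is nondegenerate, because elements of [C] are
    involutions; hence [`|G_C|^2 = u]. Now [u = 2^n] and [G_C] is a Gaussian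
    integer, so [G_C] is a unit times [(1 + i)^n]: an odd number [v - 1] of
    these cannot add up to a multiple of [u = 2^n]. *)

(** * Integer points on circles whose squared radius is a power of 2 *)

Section CharacterSums.
Local Open Scope ring_scope.

Lemma int_parity (x : int) : exists q : int, x = 2 * q \/ x = 2 * q + 1.
Proof. by exists (x %/ 2)%Z; lia. Qed.

(** Squares are 0 or 1 modulo 4, so an odd [x] or [y] is impossible. This is the descent step for
    the next two lemmas. *)
Lemma even_of_sqr_sum (x y z : int) : x ^+ 2 + y ^+ 2 = 4 * z ->
  exists x' y' : int, [/\ x = 2 * x', y = 2 * y' & x' ^+ 2 + y' ^+ 2 = z].
Proof.
have [p [] ->] := int_parity x; have [q [] ->] := int_parity y; move=> e.
all: try by nia.
by exists p, q; split=> //; lia.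
Qed.

(** Halving both coordinates [k] times leads to a sum of squares equal to 1, where exactly one
    coordinate is odd. This and the next lemma stand in for the factorization as a unit times a
    power of 1 + i. *)
Lemma sqr_sum_pow2_even k (x y : int) : x ^+ 2 + y ^+ 2 = 2 ^+ k.*2 ->
  exists w : int, x + y = 2 ^+ k * (2 * w + 1).
Proof.
elim: k x y => [|k IHk] x y.
  rewrite !expr0 => e.
  have [w ->] : exists w : int, x + y = 2 * w + 1.
    have [p [] ex] := int_parity x; have [q [] ey] := int_parity y; subst x y.
    - by nia.
    - by exists (p + q); ring.
    - by exists (p + q); ring.
    - by nia.
  by exists w; rewrite mul1r.
have -> : 2 ^+ k.+1.*2 = 4 * 2 ^+ k.*2 :> int by rewrite doubleS !exprS mulrA.
case/even_of_sqr_sum=> x' [y' [-> -> /IHk[w e]]].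
by exists w; rewrite exprS -mulrA -e; ring.
Qed.

(** The same descent ends at a sum of squares equal to 2, where both coordinates are odd; so [x]
    alone can be used here instead of [x + y]. *)
Lemma sqr_sum_pow2_odd k (x y : int) : x ^+ 2 + y ^+ 2 = 2 ^+ k.*2.+1 ->
  exists w : int, x = 2 ^+ k * (2 * w + 1).
Proof.
elim: k x y => [|k IHk] x y.
  rewrite expr1 expr0; have [p [] ->] := int_parity x.
    by have [q [] ->] := int_parity y; nia.
  by exists p; rewrite mul1r.
have -> : 2 ^+ k.+1.*2.+1 = 4 * 2 ^+ k.*2.+1 :> int.
  by rewrite doubleS !exprS !mulrA.
case/even_of_sqr_sum=> x' [y' [-> _ /IHk[w ->]]].
by exists w; rewrite exprS mulrA.
Qed.

Lemma sum_odd_multiples (I : finType) (P : {set I}) (f : I -> int) (c : int) :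
    {in P, forall i, exists w : int, f i = c * (2 * w + 1)} ->
  exists w : int, \sum_(i in P) f i = c * (2 * w + #|P|%:Z).
Proof.
move=> fP; rewrite -[#|P|%:Z]natz -sum1_card natr_sum.
apply: (big_ind2 (fun s t => exists w : int, s = c * (2 * w + t))).
- by exists 0; ring.
- by move=> _ s _ t [w ->] [z ->]; exists (w + z); ring.
by move=> i /fP[w ->]; exists w; ring.
Qed.

(** Summing an odd number of odd multiples of 2^k, with k = n/2 rounded down, gives an odd multiple
    of 2^k. The summands are the real parts if [n] is odd, and real plus imaginary parts if [n] is
    even. The right side is real, so either sum would equal m 2^n, which 2^(k+1) divides. *)
Lemma odd_sum_gaussian (I : finType) (P : {set I}) (G : I -> algC) n (m : int) :
    (0 < n)%N -> odd #|P| ->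
    {in P, forall i, 'Re (G i) \is a Num.int /\ 'Im (G i) \is a Num.int} ->
    {in P, forall i, `|G i| ^+ 2 = 2 ^+ n} ->
  \sum_(i in P) G i != m%:~R * 2 ^+ n.
Proof.
move=> n_gt0 oddP intG normG; apply/eqP=> sumG.
pose x i := Num.floor ('Re (G i)); pose y i := Num.floor ('Im (G i)).
have xE i : i \in P -> (x i)%:~R = 'Re (G i).
  by move=> /intG[? _]; rewrite floorK.
have yE i : i \in P -> (y i)%:~R = 'Im (G i).
  by move=> /intG[_ ?]; rewrite floorK.
have xyE i : i \in P -> x i ^+ 2 + y i ^+ 2 = 2 ^+ n.
  move=> Pi; apply: (@intr_inj algC).
  by rewrite rmorphD !rmorphXn /= xE // yE // -normC2_Re_Im normG // rmorph_nat.
have Rrhs : m%:~R * 2 ^+ n \is @Num.real algC.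
  by rewrite realM ?realX ?realn ?realz.
have sumx : \sum_(i in P) x i = m * 2 ^+ n.
  apply: (@intr_inj algC); rewrite rmorph_sum /= (eq_bigr _ xE) -raddf_sum sumG.
  by rewrite /= (Creal_ReP _ Rrhs) rmorphM rmorphXn.
have sumy : \sum_(i in P) y i = 0.
  apply: (@intr_inj algC); rewrite rmorph_sum /= (eq_bigr _ yE) -raddf_sum sumG.
  by rewrite /= (Creal_ImP _ Rrhs).
have contra k (w q : int) : 2 ^+ k * (2 * w + #|P|%:Z) = q * 2 ^+ k.+1 -> False.
  rewrite exprSr mulrCA => /(mulfI (expf_neq0 k (isT : 2 != 0 :> int))).
  by lia.
have /esym nE := odd_double_half n.
case oddn: (odd n) nE xyE => nE xyE.
  have /sum_odd_multiples[w] : {in P, forall i, exists w : int,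
      x i = 2 ^+ n./2 * (2 * w + 1)}.
    by move=> i Pi; apply: (@sqr_sum_pow2_odd _ _ (y i)); rewrite xyE // {1}nE.
  rewrite sumx; have n2E : n = (n./2 + n./2.+1)%N by lia.
  by rewrite {1}n2E exprD mulrA => /esym/contra.
have /sum_odd_multiples[w] : {in P, forall i, exists w : int,
    x i + y i = 2 ^+ n./2 * (2 * w + 1)}.
  by move=> i Pi; apply: sqr_sum_pow2_even; rewrite xyE // {1}nE.
rewrite big_split /= sumx sumy addr0.
(* Positivity of [n] matters here: for n = 0 the predecessor would be truncated and the split would
   fail. *)
have n2E : n = (n./2.-1 + n./2.+1)%N by lia.
by rewrite {1}n2E exprD mulrA => /esym/contra.
Qed.

Lemma Re_Im_int_sum (I : Type) (r : seq I) (P : pred I) (f : I -> algC) :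
    (forall i, P i -> f i ^+ 4 = 1) ->
  'Re (\sum_(i <- r | P i) f i) \is a Num.int /\
  'Im (\sum_(i <- r | P i) f i) \is a Num.int.
Proof.
move=> f4.
apply: (big_ind (fun z : algC => 'Re z \is a Num.int /\ 'Im z \is a Num.int)).
- by rewrite !raddf0 rpred0.
- by move=> s t [? ?] [? ?]; rewrite !raddfD /= !rpredD.
move=> i /f4 /eqP.
(* A fourth root of unity has square 1 or -1 = i^2, hence is 1, -1, i or -i. *)
rewrite (exprM _ 2 2) -[1 in X in X -> _](expr1n _ 2) eqf_sqr sqrf_eq1.
rewrite -sqrCi eqf_sqr.
have [R1 I1] : 'Re 1 = 1 :> algC /\ 'Im 1 = 0 :> algC.
  by split; [apply/Creal_ReP | apply/Creal_ImP]; rewrite rpred1.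
by case/orP=> /orP[] /eqP->; split;
  rewrite ?sqrCi ?raddfN /= ?Re_i ?Im_i ?R1 ?I1 ?oppr0 ?rpredN ?rpred0 ?rpred1.
Qed.

(** * Sums of multiplicative and quadratic functions over a finite group *)

Variables (gT : finGroupType) (G : {group gT}).
Implicit Types f h : gT -> algC.

Lemma sum_mulg_shift f y : y \in G ->
  \sum_(x in G) f (y * x)%g = \sum_(x in G) f x.
Proof.
move=> Gy; rewrite [RHS](reindex_inj (mulgI y)) /=.
by apply: eq_bigl => x; rewrite groupMl.
Qed.

(** Translation by [y] preserves the sum but also multiplies it by [h y], which is not 1. *)
Lemma sum_hom_eq0 h y :
    {in G &, forall x y, h (x * y)%g = h x * h y} -> y \in G -> h y != 1 ->
  \sum_(x in G) h x = 0.
Proof.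
move=> hM Gy hy1; apply: (mulfI (_ : h y - 1 != 0)); first by rewrite subr_eq0.
rewrite mulr0 mulrBl mul1r big_distrr /= -[X in _ - X](sum_mulg_shift _ Gy).
by apply/eqP; rewrite subr_eq0; apply/eqP/eq_bigr => x Gx; rewrite hM.
Qed.

(** The classical evaluation of a Gauss sum: write the squared norm as a double sum and replace x by
    x y. The terms with x = 1 give the order of [G]; for any other x the inner sum is [f x] times
    the sum of the nontrivial multiplicative function [p x], hence 0. *)
Lemma norm_sum_quadratic f (p : gT -> gT -> algC) :
    {in G, forall x, `|f x| = 1} -> f 1%g = 1 ->
    {in G &, forall x y, f (x * y)%g = f x * f y * p x y} ->
    {in G & &, forall x y z, p x (y * z)%g = p x y * p x z} ->
    {in (G^#)%g, forall x, exists2 y, y \in G & p x y != 1} ->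
  `|\sum_(x in G) f x| ^+ 2 = #|G|%:R.
Proof.
move=> f1 f11 fM pM pn.
rewrite normCK rmorph_sum /= big_distrr /=.
transitivity (\sum_(x in G) \sum_(y in G) f (x * y)%g * (f y)^*).
  rewrite exchange_big /=; apply: eq_bigr => y Gy; rewrite -big_distrl /=.
  congr (_ * _); rewrite (reindex_inj (mulIg y)) /=.
  by apply: eq_bigl => x; rewrite groupMr.
rewrite (bigD1 1%g) //= [X in _ + X]big1 => [|x /andP[Gx x_neq1]].
  rewrite addr0 -sumr_const; apply: eq_bigr => y Gy.
  by rewrite mul1g -normCK f1 ?expr1n.
have [y Gy py] : exists2 y, y \in G & p x y != 1.
  by apply: pn; rewrite !inE x_neq1.
transitivity (f x * \sum_(z in G) p x z).
  rewrite big_distrr /=; apply: eq_bigr => z Gz.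
  by rewrite fM // mulrAC -[_ * f z * _]mulrA -normCK f1 // expr1n mulr1.
by rewrite (@sum_hom_eq0 _ y) ?mulr0 // => z t Gz Gt; apply: pM.
Qed.

End CharacterSums.

Local Open Scope group_scope.

(** * The coordinates b a s on a group that is abelian modulo a central subgroup *)

Section Coordinates.
Variables (gT : finGroupType) (K A B As Bs : {group gT}).
Hypotheses (nAs : As <| K) (nBs : Bs <| K).
Hypotheses (sAAs : A \subset As) (sBBs : B \subset Bs).
Hypotheses (defK1 : As * B = K) (defK2 : Bs * A = K).
Hypotheses (ti1 : As :&: B = 1) (ti2 : Bs :&: A = 1).
Hypotheses (cent : As :&: Bs \subset 'Z(K)) (der : K^`(1) \subset As :&: Bs).

Local Notation alpha := (remgr Bs A).
Local Notation beta := (remgr As B).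

(** [alpha] is the projection of K = Bs A onto A along Bs, and [beta] that of K = As B onto B along
    As; [sigma] is what remains of [g] once b a is removed on the left. *)
Definition center_part (g : gT) := (beta g * alpha g)^-1 * g.
Local Notation sigma := center_part.

Lemma mem_alpha g : g \in K -> alpha g \in A.
Proof. by rewrite -defK2; apply: mem_remgr. Qed.

Lemma mem_beta g : g \in K -> beta g \in B.
Proof. by rewrite -defK1; apply: mem_remgr. Qed.

Lemma alphaM : {in K &, {morph alpha : x y / x * y}}.
Proof. by apply: remgrM => //; apply/complP. Qed.

Lemma betaM : {in K &, {morph beta : x y / x * y}}.
Proof. by apply: remgrM => //; apply/complP. Qed.

Lemma alpha_eq1 g : g \in K -> alpha g = 1 -> g \in Bs.
Proof.
by move=> Kg a1; rewrite (divgr_eq Bs A g) a1 mulg1 mem_divgr ?defK2.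
Qed.

Lemma beta_eq1 g : g \in K -> beta g = 1 -> g \in As.
Proof.
by move=> Kg b1; rewrite (divgr_eq As B g) b1 mulg1 mem_divgr ?defK1.
Qed.

Lemma sAK : A \subset K. Proof. by rewrite -defK2 mulG_subr. Qed.
Lemma sBK : B \subset K. Proof. by rewrite -defK1 mulG_subr. Qed.

Lemma coordinatesE g : g = beta g * alpha g * sigma g.
Proof. by rewrite mulKVg. Qed.

Lemma center_part_closed g : g \in K -> sigma g \in K.
Proof.
move=> Kg; rewrite groupM // groupV groupM //.
  exact: subsetP sBK _ (mem_beta Kg).
exact: subsetP sAK _ (mem_alpha Kg).
Qed.

(** The homomorphism [alpha] kills B, as B lies in Bs, and fixes A. Applied to g = b a s it
    therefore gives alpha s = 1, which puts s in Bs; symmetrically [beta] puts s in As. *)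
Lemma mem_center_part g : g \in K -> sigma g \in As :&: Bs.
Proof.
move=> Kg; have Aa := mem_alpha Kg; have Bb := mem_beta Kg.
have Ka := subsetP sAK _ Aa; have Kb := subsetP sBK _ Bb.
have Ks := center_part_closed Kg; have Kba := groupM Kb Ka.
rewrite inE beta_eq1 ?alpha_eq1 //.
  apply: (mulgI (alpha g)); rewrite mulg1 [in RHS](coordinatesE g).
  rewrite (alphaM Kba Ks) (alphaM Kb Ka).
  by rewrite (remgr1 _ (subsetP sBBs _ Bb)) (remgr_id ti2 Aa) mul1g.
apply: (mulgI (beta g)); rewrite mulg1 [in RHS](coordinatesE g).
rewrite (betaM Kba Ks) (betaM Kb Ka).
by rewrite (remgr1 _ (subsetP sAAs _ Aa)) (remgr_id ti1 Bb) mulg1.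
Qed.

Lemma center_part_cent g h : g \in K -> h \in As :&: Bs -> commute h g.
Proof. by move=> Kg /(subsetP cent)/centerP[_]; apply. Qed.

(** In b a s b' a' s' everything can be reordered freely except a and b', and a b' = b' a [a, b'],
    where the commutator lies in the derived subgroup and so is central. *)
Lemma center_partM g h : g \in K -> h \in K ->
  sigma (g * h) = sigma g * sigma h * [~ alpha g, beta h].
Proof.
move=> Kg Kh; apply: (mulgI (beta (g * h) * alpha (g * h))).
rewrite -coordinatesE alphaM // betaM //.
have Ka := subsetP sAK _ (mem_alpha Kg).
have Ka' := subsetP sAK _ (mem_alpha Kh).
have Kb := subsetP sBK _ (mem_beta Kg).
have Kb' := subsetP sBK _ (mem_beta Kh).
have Sg := mem_center_part Kg; have Sh := mem_center_part Kh.
have Sc : [~ alpha g, beta h] \in As :&: Bs.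
  by rewrite (subsetP der) // derg1 mem_commg.
have comm s x : s \in As :&: Bs -> x \in K -> s * x = x * s.
  by move=> Ss Kx; apply: center_part_cent.
have Eg := coordinatesE g; have Eh := coordinatesE h.
rewrite [g in LHS]Eg [h in LHS]Eh.
move: (alpha g) (beta g) (sigma g) (alpha h) (beta h) (sigma h)
  Ka Kb Sg Ka' Kb' Sh Sc.
move=> a b s a' b' s' Ka Kb Ss Ka' Kb' Ss' Sc.
have Ks : s \in K by rewrite (subsetP (normal_sub nAs)) //; case/setIP: Ss.
have Ks' : s' \in K by rewrite (subsetP (normal_sub nAs)) //; case/setIP: Ss'.
move: [~ a, b'] Sc (commgC a b') => c Sc Ec.
rewrite -(comm _ _ Sc (groupM Ks Ks')) -!mulgA; congr (_ * _).
rewrite (mulgA s b') (comm s b') // -(mulgA b').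
rewrite (mulgA s a') (comm s a') // -(mulgA a').
rewrite (mulgA a b') Ec -!mulgA; congr (_ * (_ * _)).
by rewrite (mulgA c) (comm c a') // !mulgA.
Qed.

End Coordinates.

(** * Coordinates of the members of a Kantor family, and the resulting sums *)

Section KantorCoordinates.
Variables (gT : finGroupType) (K : {group gT}) (u v : nat).
Variables (F Fs : {set {group gT}}) (star : {group gT} -> {group gT}).
Variables (A B : {group gT}).
Hypotheses (kf : kantor_family K u v F Fs star).
Hypotheses (FA : A \in F) (FB : B \in F) (neqAB : A != B).
Hypotheses (cent : star A :&: star B \subset 'Z(K)).
Hypotheses (abK : abelian (K / (star A :&: star B))).

Local Notation S := (star A :&: star B)%G.
Local Notation alpha := (remgr (star B) A).
Local Notation beta := (remgr (star A) B).
Local Notation sigma := (center_part A B (star A) (star B)).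
Local Notation F' := (F :\ A :\ B).

Lemma kantor_sub C : C \in F -> C \subset K.
Proof. by move=> FC; have /subsetP/(_ C FC) := kf_sub kf; rewrite inE. Qed.

Lemma kantor_star_sub C : C \in F -> star C \subset K.
Proof.
move=> FC; have /subsetP/(_ (star C)) := kf_star_sub kf.
by rewrite inE -(kf_star_im kf); apply; apply: imset_f.
Qed.

Lemma kantor_star_cap C D : C \in F -> D \in F -> C != D -> star C :&: D = 1.
Proof. by move=> FC FD neqCD; rewrite setIC (kf_cap_star kf) // eq_sym. Qed.

Lemma kantor_star_mul C D : C \in F -> D \in F -> C != D -> star C * D = K.
Proof.
move=> FC FD neqCD; apply/eqP.
rewrite eqEcard (mul_subG (kantor_star_sub FC) (kantor_sub FD)) /=.
rewrite (TI_cardMg (kantor_star_cap FC FD neqCD)).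
rewrite (kf_card_star kf) // (kf_card_mem kf) // (kf_order kf).
by rewrite mulnAC mulnn.
Qed.

(** The product A* B* is all of K, so the intersection has order (uv)^2 / (u^2 v). *)
Lemma card_star_cap : #|star A :&: star B| = v.
Proof.
have defK : star A * star B = K.
  apply/eqP; rewrite eqEsubset mul_subG ?kantor_star_sub //=.
  by rewrite -(kantor_star_mul FA FB neqAB) mulgS ?(kf_le_star kf).
have := mul_cardG (star A) (star B).
rewrite defK !(kf_card_star kf) // (kf_order kf) -mulnn mulnACA -!mulnA => /eqP.
have u_gt0 : 0 < u by apply: ltnW (kf_u_ge2 kf).
have v_gt0 : 0 < v by apply: ltnW (kf_v_ge2 kf).
by rewrite !eqn_pmul2l // => /eqP.
Qed.

Lemma derK_sub : K^`(1) \subset star A :&: star B.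
Proof.
apply: der1_min abK; apply: cents_norm; rewrite centsC.
by apply: subset_trans cent (subsetIr _ _).
Qed.

Lemma starA_normal : star A <| K.
Proof.
apply: sub_der1_normal (kantor_star_sub FA).
exact: subset_trans derK_sub (subsetIl _ _).
Qed.

Lemma starB_normal : star B <| K.
Proof.
apply: sub_der1_normal (kantor_star_sub FB).
exact: subset_trans derK_sub (subsetIr _ _).
Qed.

Let defK1 : star A * B = K := kantor_star_mul FA FB neqAB.
Let ti1 : star A :&: B = 1 := kantor_star_cap FA FB neqAB.
Let neqBA : B != A. Proof. by rewrite eq_sym. Qed.
Let defK2 : star B * A = K := kantor_star_mul FB FA neqBA.
Let ti2 : star B :&: A = 1 := kantor_star_cap FB FA neqBA.

Lemma kantor_coordinatesM : 
 [/\ {in K &, {morph alpha : x y / x * y}},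
     {in K &, {morph beta : x y / x * y}}
   & {in K &, forall x y,
       sigma (x * y) = sigma x * sigma y * [~ alpha x, beta y]}].
Proof.
split.
- exact: (alphaM starB_normal defK2 ti2).
- exact: (betaM starA_normal defK1 ti1).
move=> x y; apply: (center_partM starA_normal starB_normal) => //.
- exact: kf_le_star kf _ FA.
- exact: kf_le_star kf _ FB.
- exact: derK_sub.
Qed.

Lemma kantor_mem_coordinates x : x \in K ->
  [/\ alpha x \in A, beta x \in B & sigma x \in S].
Proof.
move=> Kx; split; [exact: (mem_alpha defK2) | exact: (mem_beta defK1) |].
apply: (mem_center_part starA_normal starB_normal) Kx => //.
- exact: kf_le_star kf _ FA.
- exact: kf_le_star kf _ FB.
Qed.

Lemma kantor_other C : C \in F' -> [/\ C \in F, C != A & C != B].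
Proof. by rewrite !inE => /and3P[]. Qed.

(** The kernel of [alpha] is B*, which meets C trivially by condition (d). *)
Lemma alpha_inj1 C x : C \in F' -> x \in C -> alpha x = 1 -> x = 1.
Proof.
move=> /kantor_other[FC CA CB] Cx ax.
have Kx := subsetP (kantor_sub FC) x Cx.
apply/set1gP; rewrite -(kantor_star_cap FB FC) 1?eq_sym // inE Cx andbT.
exact: (alpha_eq1 defK2).
Qed.

Lemma beta_inj1 C x : C \in F' -> x \in C -> beta x = 1 -> x = 1.
Proof.
move=> /kantor_other[FC CA CB] Cx bx.
have Kx := subsetP (kantor_sub FC) x Cx.
apply/set1gP; rewrite -(kantor_star_cap FA FC) 1?eq_sym // inE Cx andbT.
exact: (beta_eq1 defK1).
Qed.

(** If the central part vanishes then x = b a lies in BA, which meets C trivially by condition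
    (c). *)
Lemma center_part_neq1 C x : C \in F' -> x \in C -> sigma x = 1 -> x = 1.
Proof.
move=> /kantor_other[FC CA CB] Cx sx.
have Kx := subsetP (kantor_sub FC) x Cx.
have [Aa Bb _] := kantor_mem_coordinates Kx.
apply/set1gP; rewrite -(kf_cap3 kf FB FA FC) 1?eq_sym // inE Cx andbT.
by rewrite (coordinatesE A B (star A) (star B) x) sx mulg1 mem_mulg.
Qed.

(** Elements that agree in a and s differ by a left factor from B, so y lies in BC, which meets D
    trivially by condition (c). *)
Lemma coordinates_inj C D x y : C \in F' -> D \in F' -> C != D ->
  x \in C -> y \in D -> alpha x = alpha y -> sigma x = sigma y -> y = 1.
Proof.
move=> /kantor_other[FC CA CB] /kantor_other[FD DA DB] CD Cx Dy axy sxy.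
have Kx := subsetP (kantor_sub FC) x Cx.
have Ky := subsetP (kantor_sub FD) y Dy.
have [_ Bx _] := kantor_mem_coordinates Kx.
have [_ By _] := kantor_mem_coordinates Ky.
apply/set1gP; rewrite -(kf_cap3 kf FB FC FD _ CD) 1?eq_sym // inE Dy andbT.
have -> : y = beta y * (beta x)^-1 * x.
  rewrite {1}(coordinatesE A B (star A) (star B) y) -axy -sxy -!mulgA.
  by rewrite {4}(coordinatesE A B (star A) (star B) x) -mulgA mulKg.
by rewrite mem_mulg // groupM ?groupV.
Qed.

(** The disjoint union of the sets [C^#]; tagging each element with its member turns double sums
    into sums over pairs. *)
Definition member_pairs :=
  [set p : {group gT} * gT | (p.1 \in F') && (p.2 \in p.1^#)].

Lemma in_member_pairs p :
  (p \in member_pairs) = (p.1 \in F') && (p.2 \in p.1^#).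
Proof. by rewrite /member_pairs inE. Qed.

Lemma card_other : #|F'| = v.-1.
Proof.
have := cardsD1 A F; rewrite FA (kf_card kf).
have := cardsD1 B (F :\ A); rewrite !inE neqBA FB /= => -> /eqP.
by rewrite !add1n eqSS => /eqP->.
Qed.

Lemma card_member_pairs : #|member_pairs| = (u.-1 * v.-1)%N.
Proof.
rewrite -card_other -sum1_card.
rewrite (eq_bigl (fun p => (p.1 \in F') && (p.2 \in p.1^#))).
  rewrite -(pair_big_dep (mem F') (fun C x => x \in C^#) (fun _ _ => 1%N)) /=.
  rewrite mulnC -sum_nat_const; apply: eq_bigr => C /kantor_other[FC _ _].
  by rewrite sum1_card -(kf_card_mem kf FC) (cardsD1 1 C) group1.
by move=> p; rewrite inE.
Qed.

(** The map is injective, by [alpha] alone inside one member and by [coordinates_inj] across two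
    members. It lands in the right side, and both sides have (u - 1)(v - 1) elements. *)
Lemma coordinates_image :
  [set (alpha p.2, sigma p.2) | p in member_pairs] = setX A^# S^#.
Proof.
apply/eqP; rewrite eqEcard cardsX card_in_imset; last first.
  move=> [C x] [D y]; rewrite !in_member_pairs /=.
  move=> /andP[F'C /setD1P[x1 Cx]] /andP[F'D /setD1P[/eqP y1 Dy]].
  case=> axy sxy.
  have [eqCD | neqCD] := eqVneq C D; last first.
    by case: y1; apply: (coordinates_inj F'C F'D neqCD Cx Dy).
  rewrite -{D}eqCD in F'D Dy *; congr (_, _).
  have [FC _ _] := kantor_other F'C; have sCK := subsetP (kantor_sub FC).
  have [aM _ _] := kantor_coordinatesM.
  have axV : alpha (x * y^-1) = 1.
    apply: (mulIg (alpha y)); rewrite mul1g -aM ?groupM ?groupV ?sCK //.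
    by rewrite mulgKV.
  apply/eqP; rewrite eq_mulgV1; apply/eqP.
  by apply: (alpha_inj1 F'C) => //; rewrite groupM ?groupV.
rewrite card_member_pairs; apply/andP; split.
  apply/subsetP=> _ /imsetP[[C x] + ->].
  rewrite in_member_pairs => /andP[/= F'C].
  case/setD1P=> x1 Cx; have [FC _ _] := kantor_other F'C.
  have Kx := subsetP (kantor_sub FC) x Cx.
  have [Aa _ Ss] := kantor_mem_coordinates Kx.
  rewrite in_setX /= !in_setD1 Aa Ss !andbT.
  apply/andP; split; apply: contraNneq x1 => e1; apply/eqP.
    exact: (alpha_inj1 F'C Cx e1).
  exact: (center_part_neq1 F'C Cx e1).
rewrite -(kf_card_mem kf FA) -card_star_cap (cardsD1 1 A) (cardsD1 1 S).
by rewrite !group1.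
Qed.

Lemma coordinates_sum (h : gT -> gT -> algC) :
  (\sum_(C in F') \sum_(x in C^#) h (alpha x) (sigma x)
   = \sum_(a in A^#) \sum_(s in S^#) h a s)%R.
Proof.
rewrite !pair_big_dep /=.
transitivity (\sum_(q in setX A^# S^#) h q.1 q.2)%R; last first.
  by apply: eq_bigl => -[a s]; rewrite in_setX.
rewrite -coordinates_image big_imset /=; last first.
  apply/imset_injP; rewrite coordinates_image card_member_pairs cardsX.
  rewrite -(kf_card_mem kf FA) -card_star_cap (cardsD1 1 A) (cardsD1 1 S).
  by rewrite !group1.
by apply: eq_bigl => p; rewrite in_member_pairs.
Qed.

Lemma coordinates_surj a s : a \in A^# -> s \in S^# ->
  exists C x, [/\ C \in F', x \in C, alpha x = a & sigma x = s].
Proof.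
move=> Aa Ss; have : (a, s) \in setX A^# S^# by rewrite in_setX Aa.
rewrite -coordinates_image => /imsetP[[C x] + [-> ->]].
by rewrite in_member_pairs /= => /andP[F'C /setD1P[_ Cx]]; exists C, x.
Qed.

Lemma commutator_in x y : x \in K -> y \in K -> [~ alpha x, beta y] \in S.
Proof.
move=> Kx Ky; rewrite (subsetP derK_sub) // derg1 mem_commg //.
  by have [/(subsetP (kantor_sub FA))] := kantor_mem_coordinates Kx.
by have [_ /(subsetP (kantor_sub FB))] := kantor_mem_coordinates Ky.
Qed.

Lemma cap_cent s x : s \in S -> x \in K -> s * x = x * s.
Proof. by move=> Ss Kx; apply: (center_part_cent cent). Qed.

Lemma kantor_center_part1 : sigma 1 = 1.
Proof. by rewrite /center_part !remgr1 ?group1 // !mulg1 invg1. Qed.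

(** The v - 1 identity elements contribute 1 each. By the bijection, the other elements contribute
    the sum of [h] over [S^#], which is -1, once for each of the u - 1 elements of [A^#]. *)
Lemma sum_hom_center_part (h : gT -> algC) t :
    {in S &, forall x y, h (x * y) = (h x * h y)%R} -> h 1 = 1%R ->
    t \in S -> h t != 1%R ->
  (\sum_(C in F') \sum_(x in C) h (sigma x) = v%:R - u%:R)%R.
Proof.
move=> hM h1 St ht.
have sumS : (\sum_(s in S^#) h s = -1)%R.
  have := sum_hom_eq0 hM St ht; rewrite (big_setD1 1) ?group1 //= h1 => /eqP.
  by rewrite addrC addr_eq0 => /eqP.
have u_gt0 : 0 < u by apply: ltnW (kf_u_ge2 kf).
have v_gt0 : 0 < v by apply: ltnW (kf_v_ge2 kf).
transitivity (\sum_(C in F') (1 + \sum_(x in C^#) h (sigma x)))%R.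
  apply: eq_bigr => C _.
  by rewrite (big_setD1 1) ?group1 //= kantor_center_part1 h1.
rewrite big_split /= (coordinates_sum (fun _ => h)).
rewrite (eq_bigr _ (fun _ _ => sumS)).
rewrite !sumr_const card_other mulNrn.
have -> : #|A^#| = u.-1.
  by rewrite -(kf_card_mem kf FA) (cardsD1 1 A) group1.
rewrite -{2}(prednK u_gt0) -{2}(prednK v_gt0).
by rewrite -!natr1 opprD addrACA subrr addr0.
Qed.

(** * Members that are elementary abelian 2-groups, and the contradiction *)

Hypothesis el : forall C : {group gT}, C \in F -> 2.-abelem C.

Lemma kantor_sqr1 C x : C \in F -> x \in C -> x * x = 1.
Proof.
by move=> FC Cx; have /(abelemP (isT : prime 2))[_ /(_ x Cx)] := el FC.
Qed.

(** Take z = b a s central with nontrivial square. Since a and b commute and have trivial squares,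
    z^2 = s^2, so s is the required element. *)
Lemma exists_nontrivial_square : exponent 'Z(K) = 4 ->
  exists s, [/\ s \in S, s * s != 1 & (s * s) * (s * s) = 1].
Proof.
move=> expZ.
have [z Zz zz] : exists2 z, z \in 'Z(K) & z * z != 1.
  apply/exists_inP; apply: contraT; rewrite negb_exists_in => /forall_inP Z2.
  have : exponent 'Z(K) %| 2.
    by apply/exponentP=> z /Z2; rewrite negbK => /eqP.
  by rewrite expZ.
have /centerP[Kz cz] := Zz.
have [aM bM sM] := kantor_coordinatesM.
have [Aa Bb Ss] := kantor_mem_coordinates Kz.
have Zs := subsetP cent _ Ss.
have ab : [~ alpha z, beta z] = 1.
  apply/eqP/commgP; have Kb := subsetP (kantor_sub FB) _ Bb.
  (* Each of the three factors commutes with [beta z], since z and [sigma z] are central. *)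
  have -> : alpha z = (beta z)^-1 * z * (sigma z)^-1.
    apply: (mulIg (sigma z)); apply: (mulgI (beta z)).
    by rewrite mulgKV mulKVg mulgA -coordinatesE.
  have /centerP[_ cs] := Zs.
  apply: commute_sym; apply: commuteM; first apply: commuteM.
  - exact: commuteV (commute_refl _).
  - exact: commute_sym (cz _ Kb).
  - exact: commuteV (commute_sym (cs _ Kb)).
exists (sigma z); split=> //.
  apply: contra zz => /eqP ss1.
  rewrite (coordinatesE A B (star A) (star B) (z * z)).
  rewrite sM // ss1 ab aM // bM //.
  by rewrite (kantor_sqr1 FA Aa) (kantor_sqr1 FB Bb) !mulg1.
have /exponentP/(_ _ Zs) : exponent 'Z(K) %| 4 by rewrite expZ.
by rewrite (expgM _ 2 2).
Qed.

(** The commutator [a, b] is central, so its square is [a^2, b] = 1. Hence the square of [h] after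
    [sigma] is multiplicative on C, and its sum over C is u if it is trivial and 0 otherwise. *)
Lemma dvd_norm_sum_sqr (h : gT -> algC) C :
    {in S &, forall x y, h (x * y) = (h x * h y)%R} -> h 1 = 1%R ->
    C \in F' ->
  exists k : nat, (\sum_(x in C) h (sigma x) ^+ 2 = u%:R * k%:R)%R.
Proof.
move=> hM h1 F'C; have [FC _ _] := kantor_other F'C.
have sCK := subsetP (kantor_sub FC); have [aM bM sM] := kantor_coordinatesM.
have fM : {in C &, forall x y, h (sigma (x * y)%g) ^+ 2
    = h (sigma x) ^+ 2 * h (sigma y) ^+ 2}%R.
  move=> x y /sCK Kx /sCK Ky; have Sxy := commutator_in Kx Ky.
  have [Aa _ Ssx] := kantor_mem_coordinates Kx.
  have [_ Bb Ssy] := kantor_mem_coordinates Ky.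
  rewrite sM // (hM _ _ (groupM Ssx Ssy) Sxy) (hM _ _ Ssx Ssy) !exprMn.
  rewrite [X in (_ * X)%R]expr2 -(hM _ _ Sxy Sxy).
  suff -> : [~ alpha x, beta y] * [~ alpha x, beta y] = 1 by rewrite h1 mulr1.
  have cx : commute (alpha x) [~ alpha x, beta y].
    by apply/commute_sym/cap_cent => //; apply: (subsetP (kantor_sub FA)).
  by rewrite -expg2 -commXg // expg2 (kantor_sqr1 FA Aa) comm1g.
have [/forall_inP triv | ] := boolP [forall x in C, h (sigma x) ^+ 2 == 1]%R.
  exists 1%N; rewrite (eq_bigr (fun _ => 1%R)) => [|x Cx]; last exact/eqP/triv.
  by rewrite sumr_const (kf_card_mem kf FC) mulr1.
rewrite negb_forall_in => /exists_inP[x Cx fx]; exists 0%N.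
by rewrite mulr0 (sum_hom_eq0 fM Cx fx).
Qed.

(** [norm_sum_quadratic] applies once the form h [alpha x, beta y] is shown to be nondegenerate on
    C. The witness comes from a possibly different member D: it contains y with coordinates alpha y
    = alpha x and sigma y = s, and y^2 = 1 forces s^2 [alpha y, beta y] = 1, so [h] is not 1 on that
    commutator. As [beta] maps C onto B, some c in C has beta c = beta y. *)
Lemma norm_sum_char (h : gT -> algC) s C :
    {in S &, forall x y, h (x * y) = (h x * h y)%R} -> h 1 = 1%R ->
    {in S, forall x, `|h x| = 1}%R ->
    s \in S -> h (s * s) != 1%R -> C \in F' ->
  (`|\sum_(x in C) h (sigma x)| ^+ 2 = u%:R)%R.
Proof.
move=> hM h1 normh Ss hss F'C; have [FC _ _] := kantor_other F'C.
have sCK := subsetP (kantor_sub FC); have [aM bM sM] := kantor_coordinatesM.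
have betaC : beta @: C = B.
  apply/eqP; rewrite eqEcard card_in_imset.
    rewrite !(kf_card_mem kf) // leqnn andbT.
    apply/subsetP=> _ /imsetP[x Cx ->].
    by have [] := kantor_mem_coordinates (sCK _ Cx).
  move=> x y Cx Cy bxy; apply/eqP; rewrite eq_mulgV1; apply/eqP.
  apply: (beta_inj1 F'C); first by rewrite groupM ?groupV.
  apply: (mulIg (beta y)); rewrite mul1g -bM ?groupM ?groupV ?sCK //.
  by rewrite mulgKV.
rewrite -(kf_card_mem kf FC).
apply: (@norm_sum_quadratic _ C _ (fun x y => h [~ alpha x, beta y])).
- by move=> x /sCK/kantor_mem_coordinates[_ _ ?]; rewrite normh.
- by rewrite kantor_center_part1.
- move=> x y /sCK Kx /sCK Ky; have Sxy := commutator_in Kx Ky.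
  have [_ _ Ssx] := kantor_mem_coordinates Kx.
  have [_ _ Ssy] := kantor_mem_coordinates Ky.
  by rewrite sM // (hM _ _ (groupM Ssx Ssy) Sxy) (hM _ _ Ssx Ssy).
- move=> x y z /sCK Kx /sCK Ky /sCK Kz.
  have Sxy := commutator_in Kx Ky; have Sxz := commutator_in Kx Kz.
  have Kbz : beta z \in K.
    by have [_ /(subsetP (kantor_sub FB))] := kantor_mem_coordinates Kz.
  (* The conjugation in the commutator identity disappears because commutators are central. *)
  have -> : [~ alpha x, beta (y * z)] =
      [~ alpha x, beta z] * [~ alpha x, beta y].
    rewrite bM // commgMJ; congr (_ * _).
    by apply/conjg_fixP/commgP; apply: cap_cent.
  by rewrite (hM _ _ Sxz Sxy) mulrC.
move=> x /setD1P[x_neq1 Cx]; have Kx := sCK _ Cx.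
have [Aa _ _] := kantor_mem_coordinates Kx.
have [|| D [y [F'D Dy ay sy]]] := @coordinates_surj (alpha x) s.
- rewrite !inE Aa andbT; apply: contraNneq x_neq1 => ax.
  by apply/eqP/(alpha_inj1 F'C).
- rewrite in_setD1 Ss andbT; apply: contraNneq hss => ->.
  by rewrite mulg1 h1.
have [FD _ _] := kantor_other F'D; have Ky := subsetP (kantor_sub FD) _ Dy.
have [_ By _] := kantor_mem_coordinates Ky.
have : beta y \in beta @: C by rewrite betaC.
case/imsetP=> c Cc bc; exists c => //; rewrite -bc -ay.
apply: contra hss => /eqP hc.
have := sM _ _ Ky Ky; rewrite (kantor_sqr1 FD Dy) kantor_center_part1 sy => e1.
have Syy := commutator_in Ky Ky.
by rewrite -h1 e1 (hM _ _ (groupM Ss Ss) Syy) hc mulr1.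
Qed.

Lemma no_exponent4_center : exponent 'Z(K) <> 4.
Proof.
move=> expZ; have [s [Ss ss1 s41]] := exists_nontrivial_square expZ.
have abS : abelian S.
  apply: (abelianS cent); exact: center_abelian.
have Sss : s * s \in S by rewrite groupM.
(* The kernels of the irreducible characters of S intersect trivially, so one of them detects
   s^2. *)
have [i chi_ss] : exists i, ('chi[S]_i (s * s)%g != 1)%R.
  apply/existsP; apply: contraT => /existsPn triv; case/negP: ss1.
  rewrite -in_set1 -set1gE -(TI_cfker_irr S); apply/bigcapP=> i _.
  rewrite cfkerEirr inE (eqP (negbNE (triv i))).
  by rewrite lin_char1 //; apply/char_abelianP.
have lin : ('chi_i \is a linear_char)%R by apply/char_abelianP.
pose h := ('chi_i)%R : gT -> algC.
have hM : {in S &, forall x y, h (x * y) = (h x * h y)%R}.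
  exact: lin_charM lin.
have h1 : h 1 = 1%R by exact: lin_char1.
have normh : {in S, forall x, `|h x| = 1}%R by move=> x; apply: normC_lin_char.
have h2M : {in S &, forall x y, h (x * y)%g ^+ 2 = h x ^+ 2 * h y ^+ 2}%R.
  by move=> x y Sx Sy; rewrite hM // exprMn.
have sum1 := sum_hom_center_part hM h1 Sss chi_ss.
(* The square of [h] is again multiplicative, and its value at [s] is h (s^2), which is not 1. *)
have sum2 : (\sum_(C in F') \sum_(x in C) h (sigma x) ^+ 2 = v%:R - u%:R)%R.
  apply: (sum_hom_center_part h2M _ Ss); first by rewrite h1 expr1n.
  by rewrite expr2 -hM.
have [k sum2k] : exists k : nat,
    (\sum_(C in F') \sum_(x in C) h (sigma x) ^+ 2 = u%:R * k%:R)%R.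
  apply: (big_ind (fun z : algC => exists k : nat, z = u%:R * k%:R)%R).
  - by exists 0%N; rewrite mulr0.
  - by move=> _ _ [j ->] [l ->]; exists (j + l)%N; rewrite natrD mulrDr.
  by move=> C; apply: dvd_norm_sum_sqr.
have [n uE] : exists n, u = (2 ^ n)%N.
  have /andP[/card_pgroup oA _] := el FA.
  by exists (logn 2 #|A|); rewrite -oA (kf_card_mem kf).
have n_gt0 : 0 < n.
  by have := kf_u_ge2 kf; rewrite uE; case: (n).
(* The element s^2 has order 2 in S, so v is even and the number v - 1 of remaining members is
   odd. *)
have oddF : odd #|F'|.
  have : 2 %| v.
    rewrite -card_star_cap -(@nt_prime_order _ 2 (s * s)) //.
    exact: (@order_dvdG _ S).
  rewrite card_other dvdn2 -[in ~~ _](prednK (_ : 0 < v)) /= ?negbK //.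
  exact: ltnW (kf_v_ge2 kf).
have := @odd_sum_gaussian _ F' (fun C => \sum_(x in C) h (sigma x))%R n k
  n_gt0 oddF.
case/(_ _ _)/eqP.
(* Values of [h] on S are fourth roots of unity, since S lies in the center, of exponent 4. *)
- move=> C /kantor_other[FC _ _]; apply: Re_Im_int_sum => x Cx.
  have Kx := subsetP (kantor_sub FC) x Cx.
  have [_ _ Ssx] := kantor_mem_coordinates Kx.
  rewrite -lin_charX //.
  have /exponentP/(_ _ (subsetP cent _ Ssx)) -> :
    exponent 'Z(K) %| 4 by rewrite expZ.
  exact: lin_char1.
- by move=> C F'C; rewrite (norm_sum_char hM h1 normh Ss chi_ss F'C) uE natrX.
by rewrite sum1 -sum2 sum2k uE natrX mulrC pmulrn.
Qed.

End KantorCoordinates.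

Theorem mainTheorem1 :
  ~ exists (gT : finGroupType) (K : {group gT}) (u v : nat)
      (F Fs : {set {group gT}}) (star : {group gT} -> {group gT}),
    [/\ kantor_family K u v F Fs star,
        exists A B : {group gT},
          [/\ A \in F, B \in F, A != B,
              star A :&: star B \subset 'Z(K)
            & abelian (K / (star A :&: star B))],
        exponent 'Z(K) = 4
      & forall A : {group gT}, A \in F -> 2.-abelem A].
Proof.
case=> gT [K [u [v [F [Fs [star [kf [A [B [FA FB AB cent abK]]] expZ el]]]]]]].
exact: (no_exponent4_center kf FA FB AB cent abK el expZ).
Qed.
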